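(* Let $(G=(L\cup R,E),\mathsf{C})$ be an allocation instance whose graph has arboricity $\lambda$. Run the threshold-perturbed proportional allocation algorithm (described in the context) with $\epsilon\in(0,1/4]$, parameters $k_{v,r}$ satisfying $\frac1k\le k_{v,r}\le k$ for all $v,r$ for some number $k$ with $\epsilon\le\frac1k$, for $\tau\ge\log_{1+\epsilon}(4\lambda/\epsilon)+1$ rounds. Then $OPT\le(2+(2k+8)\epsilon)\,\mathsf{MatchWeight}$.
   Context: Allocation instance: bipartite graph $G=(L\cup R,E)$, integer capacities $\mathsf{C}_v\ge1$ for $v\in R$; $\mathsf{N}_w$ is the neighborhood of $w$. Arboricity $\lambda$: minimum number of forests into which $E$ can be partitioned. A fractional allocation assigns $\mathsf{x}_{u,v}\in[0,1]$ to each edge with $\sum_{v\in\mathsf{N}_u}\mathsf{x}_{u,v}\le1$ ($u\in L$) and $\sum_{u\in\mathsf{N}_v}\mathsf{x}_{u,v}\le\mathsf{C}_v$ ($v\in R$); $OPT$ is the maximum total weight of a fractional allocation. Threshold-perturbed proportional allocation algorithm with inputs $\tau\ge1$, $\epsilon\in(0,1/4]$, positive reals $\{k_{v,r}\}_{v\in R,1\le r\le\tau}$: initially $\beta_v=1$ for $v\in R$. For rounds $r=1,\dots,\tau$: (a) every $u\in L$ sets $\mathsf{x}_{u,v}=\beta_v/\sum_{v'\in\mathsf{N}_u}\beta_{v'}$; (b) every $v\in R$ sets $\mathsf{alloc}_v=\sum_{u\in\mathsf{N}_v}\mathsf{x}_{u,v}$; (c) $\beta_v\leftarrow\beta_v(1+\epsilon)$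 if $\mathsf{alloc}_v\le\mathsf{C}_v/(1+k_{v,r}\epsilon)$, $\beta_v\leftarrow\beta_v/(1+\epsilon)$ if $\mathsf{alloc}_v\ge\mathsf{C}_v(1+k_{v,r}\epsilon)$, unchanged otherwise. Afterwards, with $\mathsf{x},\mathsf{alloc}$ from round $\tau$, set $\mathsf{x}'_{u,v}=\frac{\mathsf{C}_v}{\mathsf{alloc}_v}\mathsf{x}_{u,v}$ if $\mathsf{alloc}_v>\mathsf{C}_v$, else $\mathsf{x}_{u,v}$. $\mathsf{MatchWeight}=\sum_{(u,v)\in E}\mathsf{x}'_{u,v}$. *)

(* Defs.v *)
From HB Require Import structures.
From mathcomp Require Import all_boot all_order all_algebra.
From mathcomp Require Import all_classical all_reals all_analysis.

Set Implicit Arguments.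
Unset Strict Implicit.
Unset Printing Implicit Defensive.

Import Order.TTheory GRing.Theory Num.Theory.
Import numFieldNormedType.Exports.

Local Open Scope ring_scope.

Definition logb (R : realType) (b x : R) : R := ln x / ln b.

Section Arboricity.
Variables L Rt : finType.
Implicit Types E F : {set L * Rt}.

(* Adjacency on the vertex set L + Rt of the undirected bipartite graph with
   edge set F. *)
Definition adj F : rel (L + Rt) := fun a b =>
  match a, b with
  | inl u, inr v | inr v, inl u => (u, v) \in F
  | _, _ => false
  end.

(* [ucycle] also accepts the empty sequence and the back-and-forth walk [:: a; b]
   along one edge, so a genuine cycle is one with at least three vertices. *)
Definition is_forest F : Prop :=
  forall s : seq (L + Rt), ucycle (adj F) s -> (size s <= 2)%N.

Definition forest_partition E (P : {set {set L * Rt}}) : Prop :=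
  finset.partition P E /\ forall F, F \in P -> is_forest F.

Lemma is_forest1 e : is_forest [set e].
Proof.
move=> s /andP[cs us]; case: e cs => u v cs.
have sub : {subset s <= [:: inl u; inr v]}.
  move=> a sa; have := next_cycle cs sa.
  case: a sa => a sa; case: (next s _) => b //=; rewrite !inE => /eqP[? ?];
    by subst; rewrite eqxx ?orbT.
exact: uniq_leq_size us sub.
Qed.

Lemma exists_forest_partition E :
  exists m, `[< exists2 P, forest_partition E P & #|P| = m >].
Proof.
exists #|[set [set e] | e in E]|; apply/asboolP.
exists [set [set e] | e in E] => //; split; last first.
  by move=> F /imsetP[e _ ->]; exact: is_forest1.
apply/and3P; split.
- apply/eqP/setP => e; apply/bigcupP/idP.
    by case=> F /imsetP[e' e'E ->]; rewrite inE => /eqP->.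
  by move=> eE; exists [set e]; [exact: imset_f | rewrite inE].
- apply/finset.trivIsetP => A B /imsetP[a _ ->] /imsetP[b _ ->] ab.
  by rewrite disjoints1 inE; apply: contraNN ab => /eqP->.
- by apply/imsetP => -[e _ /setP/(_ e)]; rewrite !inE eqxx.
Qed.

Definition arboricity E : nat := ex_minn (exists_forest_partition E).

Lemma arboricityP E :
  (exists2 P, forest_partition E P & #|P| = arboricity E) /\
  (forall P, forest_partition E P -> (arboricity E <= #|P|)%N).
Proof.
rewrite /arboricity; case: ex_minnP => m /asboolP Em min_m; split=> // P EP.
by apply: min_m; apply/asboolP; exists P.
Qed.

End Arboricity.

Section Allocation.
Variables (R : realType) (L Rt : finType).
Variables (E : {set L * Rt}) (C : Rt -> nat).

Definition nbrL (u : L) : {set Rt} := [set v | (u, v) \in E].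
Definition nbrR (v : Rt) : {set L} := [set u | (u, v) \in E].

(* Values of x outside E are irrelevant. *)
Definition fractional_allocation (x : L -> Rt -> R) : Prop :=
  [/\ forall u v, (u, v) \in E -> 0 <= x u v <= 1,
      forall u, \sum_(v in nbrL u) x u v <= 1
    & forall v, \sum_(u in nbrR v) x u v <= (C v)%:R].

Definition weight (x : L -> Rt -> R) : R := \sum_(e in E) x e.1 e.2.

(* The supremum is attained: see [OPT_max]. *)
Definition OPT : R :=
  sup [set w | exists2 x, fractional_allocation x & weight x = w]%classic.

Lemma OPT_max :
  (exists2 x, fractional_allocation x & weight x = OPT) /\
  (forall x, fractional_allocation x -> weight x <= OPT).
Proof.
pose n := #|{: L * Rt}|; pose dec (r : 'rV[R]_n) u v := r ord0 (enum_rank (u, v)).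
have cdec u v : continuous (fun r => dec r u v) by exact: coord_continuous.
have csum (I : finType) (P : pred I) (f : I -> L * Rt) :
    continuous (fun r => \sum_(i | P i) dec r (f i).1 (f i).2).
  apply: continuous_big => [|i _]; [exact: add_continuous | exact: cdec].
pose A1 := [set r : 'rV[R]_n | forall i, `[0, 1]%classic (r ord0 i)]%classic.
pose A2 := (\bigcap_u [set r : 'rV[R]_n | (\sum_(v in nbrL u) dec r u v <= 1)%R])%classic.
pose A3 := (\bigcap_v [set r : 'rV[R]_n |
  (\sum_(u in nbrR v) dec r u v <= (C v)%:R)%R])%classic.
pose A := (A1 `&` (A2 `&` A3))%classic.
have cle (f : 'rV[R]_n -> R) (y : R) :
    continuous f -> closed [set r | (f r <= y)%R]%classic.
  by move=> cf; apply: (@closed_comp _ _ f [set z | (z <= y)%R]%classic) =>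
    [r _|]; [exact: cf | exact: closed_le].
have cA : compact A.
  apply: compact_closedI.
    by apply: (@rV_compact R n (fun=> `[0, 1]%classic)) => i; exact: segment_compact.
  apply: closedI; apply: closed_bigI => w _; apply: cle.
    exact: (csum _ (mem (nbrL w)) (fun v => (w, v))).
  exact: (csum _ (mem (nbrR w)) (fun u => (u, w))).
have A0 : (A !=set0)%classic.
  exists 0; split=> [i|]; first by rewrite /= mxE in_itv /= lexx ler01.
  by split=> w _ /=; rewrite big1 ?ler01 ?ler0n // => i _; rewrite /dec mxE.
have cw : ({within A, continuous (fun r => weight (dec r))})%classic.
  by apply: continuous_subspaceT; exact: (csum _ (mem E) id).
have [r rA rmax] := EVT_max_rV A0 cA cw.
have fr : fractional_allocation (dec r).
  move: rA; rewrite inE => -[rb [rL rR]]; split.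
  - by move=> u v _; have := rb (enum_rank (u, v)); rewrite /= in_itv.
  - by move=> u; exact: rL.
  - by move=> v; exact: rR.
have ub x : fractional_allocation x -> weight x <= weight (dec r).
  move=> [xb xL xR].
  pose r' : 'rV[R]_n := \row_i let e := enum_val i in
    if e \in E then x e.1 e.2 else 0.
  have dr' u v : (u, v) \in E -> dec r' u v = x u v.
    by move=> uvE; rewrite /dec mxE enum_rankK /= uvE.
  have -> : weight x = weight (dec r').
    by apply: eq_bigr => -[u v] uvE; rewrite dr'.
  apply: rmax; rewrite in_setE; split=> [i|].
    rewrite /= mxE /=; case: ifPn => [eE|_]; last by rewrite in_itv /= lexx ler01.
    by rewrite in_itv /=; apply: xb; rewrite -surjective_pairing.
  split=> w _ /=.
    rewrite (eq_bigr (x w)) => [|v]; first exact: xL.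
    by rewrite inE => /dr'.
  rewrite (eq_bigr (x ^~ w)) => [|u]; first exact: xR.
  by rewrite inE => /dr'.
suff -> : OPT = weight (dec r) by split=> //; exists (dec r).
apply/eqP; rewrite eq_le; apply/andP; split.
  by apply: ge_sup => [|w [x fx <-]]; [exists (weight (dec r)), (dec r) | exact: ub].
apply: ub_le_sup; last by exists (dec r).
by exists (weight (dec r)) => w [x fx <-]; exact: ub.
Qed.

Section Algorithm.
Variables (eps : R) (k : Rt -> nat -> R).

Definition prop_x (beta : Rt -> R) (u : L) (v : Rt) : R :=
  beta v / \sum_(v' in nbrL u) beta v'.

Definition alloc_of (x : L -> Rt -> R) (v : Rt) : R :=
  \sum_(u in nbrR v) x u v.

Definition update (kr : Rt -> R) (beta : Rt -> R) (v : Rt) : R :=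
  let a := alloc_of (prop_x beta) v in
  if a <= (C v)%:R / (1 + kr v * eps) then beta v * (1 + eps)
  else if (C v)%:R * (1 + kr v * eps) <= a then beta v / (1 + eps)
  else beta v.

(* [priority r] is the vector beta at the end of round r, i.e. the one read by
   round r.+1; rounds are numbered from 1. *)
Fixpoint priority (r : nat) : Rt -> R :=
  if r is r'.+1 then update (k ^~ r) (priority r') else fun=> 1.

Definition round_x (r : nat) : L -> Rt -> R := prop_x (priority r.-1).

Definition output (tau : nat) (u : L) (v : Rt) : R :=
  let a := alloc_of (round_x tau) v in
  if (C v)%:R < a then (C v)%:R / a * round_x tau u v else round_x tau u v.

Definition MatchWeight (tau : nat) : R := weight (output tau).

End Algorithm.

End Allocation.

(* Main.v *)
Require Import Defs.
From mathcomp Require Import all_boot all_order all_algebra.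
From mathcomp Require Import all_classical all_reals all_analysis.
From mathcomp Require Import ring lra.
Import Order.TTheory GRing.Theory Num.Theory.
Local Open Scope ring_scope.

(** Let [b = 1 + eps] and [K = (1 + k eps) b].  A round changes [alloc v] by at
most a factor [b] per unit of disagreement between the move of [beta v] and the
moves of the other priorities; as every [kvr v r] is at least [1 / k], a vertex
whose priority has once failed to increase satisfies [C v <= K alloc v] ever
after, and one whose priority has once failed to decrease satisfies
[alloc v <= K C v].  Let [top] and [bot] be the sets where these bounds fail in
the last round: their priorities are [b ^+ (tau - 1)] and [b ^- (tau - 1)].
Every fractional allocation has weight at most the capacity outside [top] plus
the number [n] of neighbors of [top].  The capacity outside [top] is at most
[K * MatchWeight].  Each neighbor of [top] distributes one unit, so [n] is at
most [K * MatchWeight] plus what these neighbors send to [bot].  Every such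
edge carries at most [b ^- (tau - 1) <= eps / (4 lambda)], and by arboricity
there are at most [lambda (n + #|bot|)] of them; and [#|bot| <= MatchWeight]
because the vertices of [bot] are filled to capacity. *)

(** * Sparsity of graphs of bounded arboricity *)

Lemma acyclic_low_degree (T : finType) (e : rel T) (S : {set T}) :
  symmetric e -> irreflexive e ->
  (forall s, ucycle e s -> (size s <= 2)%N) ->
  S != finset.set0 ->
  exists2 x, x \in S & (#|[set y in S | e x y]| <= 1)%N.
Proof.
move=> esym eirr acyc /set0Pn[x0 x0S].
have [/exists_inP[x xS dx]|/exists_inPn hdeg] :=
  boolP [exists x in S, #|[set y in S | e x y]| <= 1]%N; first by exists x.
(* Without such a vertex, any simple path in S can be prolonged for ever. *)
suff /(_ #|T|) [x [p [_ _ up szp]]] : forall n, exists x p,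
    [/\ x \in S, path e x p, uniq (x :: p) & size p = n].
  by have := max_card (mem (x :: p)); rewrite (card_uniqP up) /= szp ltnn.
elim=> [|n [x [p [xS ep up szp]]]]; first by exists x0, [::].
have /hdeg := xS; rewrite -ltnNge => /card_gt1P[y1 [y2 [+ + y12]]].
rewrite !inE => /andP[y1S exy1] /andP[y2S exy2].
(* Paths grow at the front, so [head x p] is the predecessor of [x]. A neighbor [y] avoiding it and
   already on the path lies further back, and the segment from [x] to [y] closes into a cycle of at
   least three vertices. *)
have [y [yS exy yh]] : exists y, [/\ y \in S, e x y & y != head x p].
  have [y1h|y1h] := eqVneq y1 (head x p); last by exists y1.
  by exists y2; split=> //; rewrite -y1h eq_sym.
have [yp|yp] := boolP (y \in x :: p); last first.
  by exists y, (x :: p); rewrite /= esym exy ep szp yp.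
have yx : y != x by apply: contraTneq exy => ->; rewrite eirr.
move: yp; rewrite inE (negPf yx) /= => yp.
case/splitPr: yp szp ep up yh => -[|z p1] p2 _; first by rewrite /= eqxx.
move=> ep up _.
suff /acyc : ucycle e (x :: rcons (z :: p1) y) by rewrite /= size_rcons.
apply/andP; split.
  rewrite /cycle rcons_path last_rcons esym exy andbT.
  by move: ep; rewrite -cat_rcons cat_path => /andP[].
by move: up; rewrite -cat_rcons -cat_cons cat_uniq => /andP[].
Qed.

Section Sparsity.
Variables L Rt : finType.
Implicit Types (E F : {set L * Rt}) (S : {set L + Rt}).

Lemma adj_sym F : symmetric (adj F).
Proof. by case=> a [] b. Qed.

Lemma adj_irr F : irreflexive (adj F).
Proof. by case. Qed.

Definition edges_in F S : {set L * Rt} :=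
  [set e in F | (inl e.1 \in S) && (inr e.2 \in S)].

(** Induction on [#|S|]: a forest has a vertex of degree at most one inside [S], and deleting it
    loses at most one edge. *)
Lemma card_forest_edges_in F S : is_forest F -> (#|edges_in F S| <= #|S|)%N.
Proof.
move=> fF; have [n] := ubnP #|S|; elim: n S => // n IHn S.
have [->|S0] := eqVneq S finset.set0.
  suff -> : edges_in F finset.set0 = finset.set0 by rewrite !cards0.
  by apply/finset.setP => e; rewrite !inE /= andbF.
have [x xS dx] := acyclic_low_degree _ _ S (adj_sym F) (adj_irr F) fF S0.
rewrite (cardsD1 x S) xS add1n !ltnS => szS.
have {IHn} IHS := IHn _ szS.
pose D := edges_in F S :\: edges_in F (S :\ x).
suff Dle : (#|D| <= 1)%N.
  rewrite -(cardsID (edges_in F (S :\ x)) (edges_in F S)) addnC -add1n.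
  apply: leq_add => //; apply: leq_trans IHS.
  by apply: subset_leq_card; apply/fintype.subsetP => e; rewrite inE => /andP[].
apply: leq_trans dx.
have Dx e : e \in D -> [&& e \in F, inl e.1 \in S, inr e.2 \in S &
    (inl e.1 == x) || (inr e.2 == x)].
  rewrite !inE => /andP[+ /andP[eF /andP[e1 e2]]].
  by rewrite eF e1 e2 !andbT /= -negb_or negbK.
(* All lost edges share the endpoint [x], so they are counted injectively by their other
   endpoint. *)
clear -Dx; case: x D Dx => [u|v] D Dx.
- have /card_in_imset <- : {in D &, injective (fun e => inr e.2 : L + Rt)}.
    move=> [a b] [a' b'] /Dx /and4P[_ _ _ /orP[/eqP /= [->]|//]].
    by move=> /Dx /and4P[_ _ _ /orP[/eqP /= [->]|//]] [->].
  apply: subset_leq_card; apply/fintype.subsetP => y /imsetP[[a b] /Dx + ->].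
  move=> /and4P[eF _ bS /orP[/eqP /= [<-]|//]].
  by rewrite inE bS.
- have /card_in_imset <- : {in D &, injective (fun e => inl e.1 : L + Rt)}.
    move=> [a b] [a' b'] /Dx /and4P[_ _ _ /orP[//|/eqP /= [->]]].
    by move=> /Dx /and4P[_ _ _ /orP[//|/eqP /= [->]]] [->].
  apply: subset_leq_card; apply/fintype.subsetP => y /imsetP[[a b] /Dx + ->].
  move=> /and4P[eF aS _ /orP[//|/eqP /= [<-]]].
  by rewrite inE aS.
Qed.

Lemma card_edges_in E S : (#|edges_in E S| <= arboricity E * #|S|)%N.
Proof.
have [[P [/and3P[/eqP covP trivP _] forP] <-] _] := arboricityP E.
rewrite -sum1_card (eq_bigl (fun e => (e \in finset.cover P) &&
  ((inl e.1 \in S) && (inr e.2 \in S)))); last by move=> e; rewrite covP inE.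
rewrite finset.big_trivIset_cond // /= -sum_nat_const.
apply: leq_sum => F FP; apply: leq_trans (card_forest_edges_in F S (forP _ FP)).
by rewrite -sum1_card eq_leq //; apply: eq_bigl => e; rewrite inE.
Qed.

End Sparsity.

(** * Proportional allocations and the covering bound *)

Section Analysis.
Variables (R : realType) (L Rt : finType) (E : {set L * Rt}) (C : Rt -> nat).
Implicit Types (x : L -> Rt -> R) (beta : Rt -> R) (T : {set Rt}).

Lemma weightE x : weight E x = \sum_v alloc_of E x v.
Proof.
rewrite /weight /alloc_of (exchange_big_dep predT) //= pair_big_dep /=.
by apply: eq_bigl => -[u v]; rewrite inE.
Qed.

Definition nbrs T : {set L} := [set u | [exists v in T, (u, v) \in E]].

(** Weak duality: [~: T] and [nbrs T] together cover every edge. An edge into [~: T] is charged to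
    the capacity there, any other edge to the unit budget of its left endpoint. *)
Lemma fractional_weight_le x T : fractional_allocation E C x ->
  weight E x <= \sum_(v in ~: T) (C v)%:R + #|nbrs T|%:R.
Proof.
move=> [x01 xL xR]; rewrite weightE (bigID (mem (~: T))) /=; apply: lerD.
  by apply: ler_sum => v _; exact: xR.
rewrite (eq_bigl (mem T)) => [|v]; last by rewrite /= inE negbK.
rewrite /alloc_of (exchange_big_dep (mem (nbrs T))) /=; last first.
  by move=> v u vT; rewrite !inE => uv; apply/exists_inP; exists v.
rewrite -sum1_card natr_sum; apply: ler_sum => u _.
apply: le_trans (xL u); rewrite [leRHS](bigID (mem T)) /=.
rewrite [leLHS](eq_bigl (fun v => (v \in nbrL E u) && (v \in T))); last first.
  by move=> v; rewrite !inE andbC.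
rewrite lerDl; apply: sumr_ge0 => v /andP[]; rewrite inE => uv _.
by case/andP: (x01 _ _ uv).
Qed.

Lemma prop_x_sum beta u : (forall w, 0 < beta w) -> nbrL E u != finset.set0 ->
  \sum_(v in nbrL E u) prop_x E beta u v = 1.
Proof.
move=> b0 /set0Pn[v uv]; rewrite /prop_x -mulr_suml divff // gt_eqF //.
by rewrite (bigD1 v) //= ltr_pwDl // sumr_ge0 // => w _; exact: ltW.
Qed.

Lemma sum_nbrL_gt0 beta u v : (forall w, 0 < beta w) -> (u, v) \in E ->
  0 < \sum_(w in nbrL E u) beta w.
Proof.
move=> b0 uv; rewrite (bigD1 v) ?inE //= ltr_pwDl // sumr_ge0 // => w _.
exact: ltW.
Qed.

Lemma prop_x_ge0 beta u v : (forall w, 0 < beta w) -> 0 <= prop_x E beta u v.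
Proof.
by move=> b0; rewrite divr_ge0 ?sumr_ge0 // => [|w _]; exact: ltW.
Qed.

Lemma prop_x_le_ratio beta u v w : (forall w, 0 < beta w) ->
  (u, w) \in E -> prop_x E beta u v <= beta v / beta w.
Proof.
move=> b0 uw; rewrite ler_pM2l // lef_pV2 ?posrE //; last exact: sum_nbrL_gt0 uw.
rewrite (bigD1 w) ?inE //= lerDl sumr_ge0 // => z _; exact: ltW.
Qed.

(** The numerator of each share of [v] grows by at least [c] and its denominator by at most [b].
    Consecutive rounds are compared this way in both directions, with [c] one of [b], [1],
    [b^-1]. *)
Lemma alloc_of_le beta beta' b c v :
  (forall w, 0 < beta w) -> (forall w, 0 < beta' w) ->
  (forall w, beta' w <= b * beta w) -> c * beta v <= beta' v ->
  c * alloc_of E (prop_x E beta) v <= b * alloc_of E (prop_x E beta') v.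
Proof.
move=> b0 b0' hb hc; rewrite /alloc_of !mulr_sumr; apply: ler_sum => u.
rewrite inE => uv; rewrite /prop_x !mulrA.
have s0 := sum_nbrL_gt0 _ _ _ b0 uv; have s0' := sum_nbrL_gt0 _ _ _ b0' uv.
have bs : \sum_(w in nbrL E u) beta' w <= b * \sum_(w in nbrL E u) beta w.
  by rewrite mulr_sumr ler_sum.
have bp : 0 < b by rewrite -(pmulr_lgt0 _ (b0 v)) (lt_le_trans (b0' v)).
rewrite ler_pdivrMr // mulrAC ler_pdivlMr //.
apply: le_trans (_ : beta' v * \sum_(w in nbrL E u) beta' w <= _).
  by rewrite ler_pM2r.
by rewrite -mulrA mulrCA ler_pM2l.
Qed.

Lemma alloc_of_output (eps : R) kvr t v :
  alloc_of E (output E C eps kvr t) v =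
  Num.min (alloc_of E (round_x E C eps kvr t) v) (C v)%:R.
Proof.
rewrite {1}/alloc_of /output; case: ltP => [lt|le] //.
rewrite -mulr_sumr -/(alloc_of _ _ _) divfK //.
by rewrite gt_eqF // (le_lt_trans _ lt).
Qed.

(** * Invariants maintained from round to round *)

Section Rounds.
Variables (eps k : R) (kvr : Rt -> nat -> R) (t : nat).
Hypothesis eps0 : 0 < eps.
Hypothesis hkvr : forall v r, (1 <= r <= t)%N -> 1 / k <= kvr v r <= k.
Hypothesis hk : eps <= 1 / k.

Local Notation b := (1 + eps).
Local Notation beta := (priority E C eps kvr).
Local Notation alloc r := (alloc_of E (prop_x E (beta r))).

Let b0 : 0 < b. Proof. exact: addr_gt0. Qed.

Lemma priority_gt0 r v : 0 < beta r v.
Proof.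
elim: r => //= r IHr; rewrite /update; case: ifP => _; first exact: mulr_gt0.
by case: ifP => _ //; exact: divr_gt0.
Qed.

Lemma priorityS_le r v : beta r.+1 v <= b * beta r v.
Proof.
move: eps0 (priority_gt0 r v) => e0 p /=; rewrite /update.
case: ifP => _; first by nra.
case: ifP => _; last by nra.
by rewrite ler_pdivrMr //; nra.
Qed.

Lemma priorityS_ge r v : beta r v <= b * beta r.+1 v.
Proof.
move: eps0 (priority_gt0 r v) => e0 p /=; rewrite /update.
case: ifP => _; first by nra.
case: ifP => _; last by nra.
by rewrite mulrC divfK // gt_eqF.
Qed.

Lemma allocS_ge r v c :
  c * beta r v <= beta r.+1 v -> c * alloc r v <= b * alloc r.+1 v.
Proof.
apply: alloc_of_le; [exact: priority_gt0..|exact: priorityS_le].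
Qed.

Lemma allocS_le r v c :
  c * beta r.+1 v <= beta r v -> c * alloc r.+1 v <= b * alloc r v.
Proof.
apply: alloc_of_le; [exact: priority_gt0..|exact: priorityS_ge].
Qed.

(** From [0 < eps <= 1 / k] follows [0 < k], and then [1 / k <= k] forces [1 <= k]. *)
Lemma threshold_bounds v r : (1 <= r <= t)%N ->
  [/\ b <= 1 + k * eps, 1 <= 1 + kvr v r * eps
     & 1 + kvr v r * eps <= 1 + k * eps].
Proof.
move: eps0 hk => e0 ek /(hkvr v) /andP[k1 k2].
have k0 : 0 < k by rewrite -invr_gt0 -div1r (lt_le_trans eps0).
have k3 : 1 / k <= k by exact: le_trans k1 k2.
have kv0 : 0 < kvr v r by rewrite (lt_le_trans _ k1) // divr_gt0.
have : 1 <= k by move: k3; rewrite ler_pdivrMr //; nra.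
by split; nra.
Qed.

(** An increase of [beta v] cannot lower its allocation, so the invariant persists. An unchanged
    priority had allocation above the lower threshold and loses at most a factor [b]. A decreased
    one had allocation at least [C v] and loses at most [b ^+ 2], which [b <= 1 + k * eps]
    absorbs. *)
Lemma priority_max_or_saturated r v : (r <= t)%N ->
  beta r v = b ^+ r \/ (C v)%:R <= (1 + k * eps) * b * alloc r v.
Proof.
elim: r => [|r IHr] rt; first by left; rewrite expr0.
have [bK q1 qK] := threshold_bounds v r.+1 rt.
have e0 := eps0; have C0 : 0 <= (C v)%:R :> R by [].
have a0 : 0 <= alloc r v.
  by apply: sumr_ge0 => u _; apply: prop_x_ge0; exact: priority_gt0.
have bV := allocS_ge r v b; have bV1 := allocS_ge r v 1.
have bVV := allocS_ge r v b^-1.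
move: bV bV1 bVV; move: (alloc r.+1 v) => a'; rewrite /= /update.
case: ifPn => [le bV _ _|].
  have aa' : alloc r v <= a' by rewrite -(ler_pM2l b0) bV // mulrC.
  have [->|h] := IHr (ltnW rt); first by left; rewrite exprSr.
  right; apply: (le_trans h); rewrite ler_pM2l //; nra.
rewrite -ltNge ltr_pdivrMr; last by lra.
move=> lt; case: ifPn => [le _ _ bV|_ _ bV _]; right.
  have {bV} : b^-1 * alloc r v <= b * a' by apply: bV; rewrite mulrC.
  rewrite mulrC ler_pdivrMr // => h.
  rewrite -(ler_pM2r b0).
  apply: (@le_trans _ _ ((1 + k * eps) * ((C v)%:R * (1 + kvr v r.+1 * eps)))).
    apply: le_trans (ler_wpM2l C0 bK) _.
    by rewrite mulrC ler_wpM2l ?ler_peMr //; lra.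
  by rewrite -!mulrA ler_pM2l ?mulrA ?(le_trans le) //; lra.
have {}bV : 1 * alloc r v <= b * a' by apply: bV; rewrite mul1r.
by rewrite mul1r in bV; nra.
Qed.

Lemma priority_min_or_unsaturated r v : (r <= t)%N ->
  beta r v = (b ^+ r)^-1 \/ alloc r v <= (1 + k * eps) * b * (C v)%:R.
Proof.
elim: r => [|r IHr] rt; first by left; rewrite expr0 invr1.
have [bK q1 qK] := threshold_bounds v r.+1 rt.
have e0 := eps0; have C0 : 0 <= (C v)%:R :> R by [].
have bV := allocS_le r v b; have bV1 := allocS_le r v 1.
have bVV := allocS_le r v b^-1.
move: bV bV1 bVV; move: (alloc r.+1 v) => a'; rewrite /= /update.
case: ifPn => [le _ _ bV|_]; last case: ifPn => [le bV _ _|].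
- right; have {bV} : b^-1 * a' <= b * alloc r v.
    by apply: bV; rewrite mulrCA mulVf ?mulr1 // gt_eqF.
  rewrite mulrC ler_pdivrMr // => h.
  move: le; rewrite ler_pdivlMr; last by lra.
  move=> le; apply: (le_trans h).
  have a0 : 0 <= alloc r v.
    by apply: sumr_ge0 => u _; apply: prop_x_ge0; exact: priority_gt0.
  rewrite [leRHS]mulrAC ler_pM2r // ler_pM ?(ltW b0) //.
  by apply: le_trans le; rewrite ler_peMr.
- have aa' : a' <= alloc r v.
    by rewrite -(ler_pM2l b0) bV // mulrC divfK // gt_eqF.
  have [->|h] := IHr (ltnW rt); first by left; rewrite exprSr invfM.
  by right; exact: le_trans aa' h.
rewrite -ltNge => lt _ bV _; right.
have {}bV : 1 * a' <= b * alloc r v by apply: bV; rewrite mul1r.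
rewrite mul1r in bV; apply: (le_trans bV).
rewrite -mulrA mulrCA ler_pM2l // (le_trans (ltW lt)) //.
by rewrite mulrC ler_wpM2r.
Qed.

End Rounds.
End Analysis.

(** * Comparison of the optimum with the output of the last round *)

Theorem theorem6 (R : realType) (L Rt : finType) (E : {set L * Rt})
    (C : Rt -> nat) (hC : forall v, (1 <= C v)%N)
    (lambda : nat) (hlambda : arboricity E = lambda)
    (eps : R) (heps0 : 0 < eps) (heps1 : eps <= 1 / 4)
    (tau : nat) (htau1 : (1 <= tau)%N)
    (kvr : Rt -> nat -> R)
    (hkvr0 : forall v r, (1 <= r <= tau)%N -> 0 < kvr v r)
    (k : R)
    (hkvr : forall v r, (1 <= r <= tau)%N -> 1 / k <= kvr v r <= k)
    (hk : eps <= 1 / k)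
    (htau : logb (1 + eps) (4 * lambda%:R / eps) + 1 <= tau%:R) :
  OPT R E C <= (2 + (2 * k + 8) * eps) * MatchWeight E C eps kvr tau.
Proof.
(* Round [t.+1] reads the priorities left by [t] updates, hence the exponent [tau - 1]. *)
case: tau htau1 hkvr0 hkvr htau => // t _ _ hkvr htau.
have hkvr_t v r : (1 <= r <= t)%N -> 1 / k <= kvr v r <= k.
  by case/andP=> r1 rt; apply: hkvr; rewrite r1 leqW.
pose b := 1 + eps; pose beta := priority E C eps kvr t.
pose alloc := alloc_of E (prop_x E beta).
pose K := (1 + k * eps) * b.
pose m v := Num.min (alloc v) (C v)%:R.
have k0 : 0 < k by rewrite -invr_gt0 -div1r (lt_le_trans heps0).
have ke1 : k * eps <= 1 by move: hk; rewrite ler_pdivlMr // mulrC.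
have ke0 : 0 < k * eps by exact: mulr_gt0.
have K1 : 1 <= K by rewrite /K /b; nra.
have K2 : 2 * K <= 2 + 2 * k * eps + 4 * eps by rewrite /K /b; nra.
have beta0 v : 0 < beta v by exact: priority_gt0.
have alloc0 v : 0 <= alloc v by apply: sumr_ge0 => u _; exact: prop_x_ge0.
have m0 v : 0 <= m v by rewrite le_min alloc0 ler0n.
pose W := \sum_v m v.
have -> : MatchWeight E C eps kvr t.+1 = W.
  rewrite /MatchWeight weightE; apply: eq_bigr => v _.
  exact: alloc_of_output.
have msub (P : pred Rt) : \sum_(v | P v) m v <= W.
  by rewrite /W [leRHS](bigID P) /= lerDl sumr_ge0.
(* Defining these sets by the failing bounds rather than by the priorities makes
   [m v = C v] on [bot] immediate, without excluding [tau = 1]. *)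
pose top := [set v | K * alloc v < (C v)%:R].
pose bot := [set v | K * (C v)%:R < alloc v].
have topE v : v \in top -> beta v = b ^+ t.
  rewrite inE => h.
  have [//|] := priority_max_or_saturated _ _ _ E C _ _ _ _
    heps0 hkvr_t hk _ v (leqnn t).
  by rewrite leNgt h.
have botE v : v \in bot -> beta v = (b ^+ t)^-1.
  rewrite inE => h.
  have [//|] := priority_min_or_unsaturated _ _ _ E C _ _ _ _
    heps0 hkvr_t hk _ v (leqnn t).
  by rewrite leNgt h.
have bt1 : 1 <= b ^+ t by rewrite exprn_ege1 // /b; lra.
have bt : lambda%:R / b ^+ t <= eps / 4.
  (* For [lambda = 0] the logarithm has only a default value, but the left side vanishes. *)
  case: lambda {hlambda} htau => [_|l htau]; first by rewrite mul0r; lra.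
  have x0 : 0 < 4 * l.+1%:R / eps by rewrite divr_gt0 // mulr_gt0.
  have : 4 * l.+1%:R / eps <= b ^+ t.
    rewrite -ler_ln ?posrE ?exprn_gt0 //; last by rewrite /b; lra.
    rewrite lnXn ?/b; last by lra.
    rewrite -[leRHS]mulr_natl -ler_pdivrMr; last by rewrite ln_gt0 //; lra.
    by move: htau; rewrite -[t.+1%:R]natr1 lerD2r.
  rewrite !ler_pdivrMr //; last by lra.
  by rewrite mulrAC ler_pdivlMr; nra.
pose N := nbrs L Rt E top.
have uncov : \sum_(v in ~: top) (C v)%:R <= K * W.
  apply: le_trans (_ : K * \sum_(v in ~: top) m v <= _); last first.
    by rewrite ler_pM2l ?msub //; lra.
  rewrite mulr_sumr; apply: ler_sum => v; rewrite !inE -leNgt => h.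
  by rewrite /m; case: (leP (alloc v) (C v)%:R) => // _; rewrite ler_peMl.
have hB : #|bot|%:R <= W.
  apply: le_trans (msub (mem bot)).
  rewrite -sum1_card natr_sum; apply: ler_sum => v; rewrite inE => h.
  have C1 : 1 <= (C v)%:R :> R by rewrite ler1n.
  rewrite le_min C1 andbT (le_trans C1) // (le_trans _ (ltW h)) //.
  by rewrite ler_peMl.
have hN : #|N|%:R <= K * W + eps / 4 * (#|N|%:R + #|bot|%:R).
  have Nsum : #|N|%:R = \sum_(u in N) \sum_(v in nbrL E u) prop_x E beta u v.
    rewrite -sum1_card natr_sum; apply: eq_bigr => u.
    rewrite inE => /exists_inP[w _ uw]; rewrite prop_x_sum //.
    by apply/set0Pn; exists w; rewrite inE.
  rewrite {1}Nsum (eq_bigr _ (fun u _ => bigID (mem bot) _ _)) big_split /= addrC.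
  apply: lerD.
    rewrite (exchange_big_dep (mem (~: bot))) /=; last first.
      by move=> u v _ /andP[_]; rewrite finset.in_setC.
    apply: le_trans (_ : \sum_(v in ~: bot) K * m v <= _); last first.
      by rewrite -mulr_sumr ler_pM2l ?msub //; lra.
    apply: ler_sum => v vbot; apply: le_trans (_ : alloc v <= _).
      rewrite /alloc /alloc_of [leRHS](bigID (mem N)) /=.
      rewrite (eq_bigl (fun u => (u \in nbrR E v) && (u \in N))); last first.
        by move=> u; move: vbot; rewrite !inE => ->; rewrite andbT andbC.
      by rewrite lerDl sumr_ge0 // => u _; exact: prop_x_ge0.
    move: vbot; rewrite !inE -leNgt => h.
    by rewrite /m; case: (leP (alloc v) (C v)%:R) => // _; rewrite ler_peMl.
  (* The edges from [N] to [bot] are exactly those induced by [S], so sparsity bounds their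
     number. *)
  pose S : {set L + Rt} := (inl @: N) :|: (inr @: bot).
  have inSl u : (inl u \in S) = (u \in N).
    rewrite finset.in_setU mem_imset; last by move=> ? ? [].
    by case: imsetP => [[]|]; rewrite ?orbF.
  have inSr v : (inr v \in S) = (v \in bot).
    rewrite finset.in_setU orbC mem_imset; last by move=> ? ? [].
    by case: imsetP => [[]|]; rewrite ?orbF.
  have Ssz : (#|S| <= #|N| + #|bot|)%N.
    apply: leq_trans (leq_card_setU _ _) _.
    by apply: leq_add; exact: leq_imset_card.
  rewrite pair_big_dep /= (eq_bigl (fun e => e \in edges_in L Rt E S)); last first.
    by move=> [u v]; rewrite [RHS]inE /= inSl inSr [_ \in nbrL _ _]inE andbCA.
  apply: le_trans (_ : \sum_(e in edges_in L Rt E S) (b ^+ t)^-1 <= _).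
    apply: ler_sum => -[u v]; rewrite inE /= inSl inSr => /and3P[_ + vb].
    rewrite inE => /exists_inP[w wt uw].
    apply: le_trans (prop_x_le_ratio _ _ _ E beta u v w beta0 uw) _.
    (* The ratio is [b ^- (2 * t)]; a single factor [b ^- t] suffices. *)
    rewrite (topE _ wt) (botE _ vb) ler_pdivrMr ?(lt_le_trans ltr01) //.
    by rewrite ler_peMr // invr_ge0 (le_trans ler01).
  rewrite sumr_const -[leLHS]mulr_natl.
  apply: le_trans (_ : (lambda * (#|N| + #|bot|))%:R * (b ^+ t)^-1 <= _).
    rewrite ler_wpM2r ?invr_ge0 ?(le_trans ler01) // ler_nat -hlambda.
    by apply: leq_trans (card_edges_in _ _ _ _) _; rewrite leq_mul2l Ssz orbT.
  by rewrite natrM natrD mulrAC ler_wpM2r // addr_ge0.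
have [[x fx <-] _] := @OPT_max R L Rt E C.
have := fractional_weight_le _ _ _ _ _ _ top fx; rewrite -/N => hx.
have W0 : 0 <= W by rewrite sumr_ge0.
(* Here [K <= 5 / 2] and [eps <= 1 / 4]. This coarse bound makes the error term of [hN] at most
   [eps * W], so the optimum is at most [(2 * K + eps) * W], and [K2] concludes. *)
have N3 : #|N|%:R <= 3 * W by nra.
nra.
Qed.
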